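(* Let $\mathcal W$ be the Witt algebra, i.e. the complex Lie algebra with basis $\{L_n\mid n\in\mathbb Z\}$ and bracket $[L_m,L_n]=(m-n)L_{m+n}$ for $m,n\in\mathbb Z$. For $\delta\in\mathbb C$ let $\mathfrak{BD}^{[\delta]}(\mathcal W)$ be the space of $\delta$-biderivations of $\mathcal W$. Let $\pi:\mathcal W\times\mathcal W\to\mathcal W$ be the bilinear map with $\pi(L_i,L_j)=[L_i,L_j]$, and for $n\in\mathbb Z$ let $\theta_n:\mathcal W\times\mathcal W\to\mathcal W$ be the bilinear map with $\theta_n(L_i,L_j)=L_{n+i+j}$, for all $i,j\in\mathbb Z$. Then $$\mathfrak{BD}^{[\delta]}(\mathcal W)=\begin{cases}\mathbb C\,\pi & \text{if }\delta=1;\\ \mathrm{span}_{\mathbb C}\{\theta_n\mid n\in\mathbb Z\} & \text{if }\delta=\tfrac12;\\ 0 & \text{otherwise.}\end{cases}$$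
   Context: All vector spaces are over $\mathbb C$. For $\delta\in\mathbb C$ and a Lie algebra $\mathcal L$, a $\delta$-biderivation of $\mathcal L$ is a bilinear map $f:\mathcal L\times\mathcal L\to\mathcal L$ such that for all $x,y,z\in\mathcal L$: $\delta[x,f(y,z)]+\delta[f(x,z),y]=f([x,y],z)$ and $\delta[f(x,y),z]+\delta[y,f(x,z)]=f(x,[y,z])$. The space of $\delta$-biderivations of $\mathcal L$ (for fixed $\delta$) is denoted $\mathfrak{BD}^{[\delta]}(\mathcal L)$. *)

(* Defs.v *)
From HB Require Import structures.
From mathcomp Require Import all_boot all_order all_algebra.
From mathcomp Require Import boolp classical_sets functions reals.
From mathcomp Require Import finmap complex monalg.
From mathcomp Require Import ring.

Set Implicit Arguments.
Unset Strict Implicit.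
Unset Printing Implicit Defensive.

Import GRing.Theory.
Local Open Scope ring_scope.
Local Open Scope classical_set_scope.

HB.mixin Record Lmodule_isLieAlgebra (K : comNzRingType) L
    of GRing.Lmodule K L := {
  lie : L -> L -> L;
  lie_bilinear : bilinear_for *:%R *:%R lie;
  liexx : forall x, lie x x = 0;
  lie_jacobi : forall x y z,
    lie x (lie y z) + lie y (lie z x) + lie z (lie x y) = 0
}.

#[short(type="lieAlgType")]
HB.structure Definition LieAlgebra (K : comNzRingType) :=
  {L of GRing.Lmodule K L & Lmodule_isLieAlgebra K L}.

Definition biderivation (K : comNzRingType) (L : lieAlgType K) (delta : K) :
    set (L -> L -> L) :=
  [set f | [/\ bilinear_for *:%R *:%R f,
    (forall x y z,
       delta *: lie x (f y z) + delta *: lie (f x z) y = f (lie x y) z) &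
    (forall x y z,
       delta *: lie (f x y) z + delta *: lie y (f x z) = f x (lie y z))]].

Definition linear_span (K : nzRingType) (V : lmodType K) (A : set V) : set V :=
  [set v | exists (n : nat) (c : 'I_n -> K) (a : 'I_n -> V),
     (forall i, A (a i)) /\ v = \sum_(i < n) c i *: a i].

(* Finitely supported functions int -> K, with only their K-module structure. *)
Definition witt (K : comNzRingType) : Type := {malg K[int]}.
HB.instance Definition _ (K : comNzRingType) :=
  GRing.Lmodule.copy (witt K) {malg K[int]}.

Section Witt.
Variable K : comNzRingType.
Implicit Types (x y z : witt K).

Definition wittL (n : int) : witt K := mkmalgU n 1.

Lemma wittE x : x = \sum_(k <- msupp x) mcoeff k x *: wittL k.
Proof.
rewrite {1}(monalgE x); apply: eq_bigr => k _.
by apply/malgP => i; rewrite mcoeffU (mcoeffZ (K := int)) mcoeffU mulrnAr mulr1.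
Qed.

Lemma witt_ind (P : witt K -> Prop) :
  (forall (c : K) x y, P x -> P y -> P (c *: x + y)) -> P 0 ->
  (forall n, P (wittL n)) -> forall x, P x.
Proof.
move=> PD P0 PL x; rewrite (wittE x).
elim: (enum_fset _) => [|k s IH]; first by rewrite big_nil.
by rewrite big_cons; apply: PD.
Qed.

Section Ext.
Variable V : lmodType K.

Definition witt_ext (h : int -> V) (x : witt K) : V :=
  \sum_(k <- msupp x) mcoeff k x *: h k.

Lemma witt_extEw (h : int -> V) x (d : {fset int}) : fsubset (msupp x) d ->
  witt_ext h x = \sum_(k <- d) mcoeff k x *: h k.
Proof.
move=> le; rewrite /witt_ext (big_fset_incl _ le) // => k _ /mcoeff_outdom ->.
by rewrite scale0r.
Qed.

Lemma witt_ext_linear (h : int -> V) : linear (witt_ext h).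
Proof.
move=> c x y; pose d := fsetU (msupp x) (msupp y).
have lx : fsubset (msupp x) d by exact: fsubsetUl.
have ly : fsubset (msupp y) d by exact: fsubsetUr.
have lz : fsubset (msupp (c *: x + y : {malg K[int]})) d.
  apply: fsubset_trans (msuppD_le _ _) _.
  by apply: fsetUSS => //; exact: msuppZ_le.
rewrite (witt_extEw h lx) (witt_extEw h ly) (@witt_extEw h (c *: x + y) d lz).
rewrite scaler_sumr -big_split /=; apply: eq_bigr => k _.
by rewrite scalerA -scalerDl -(mcoeffZ (K := int)) -mcoeffD.
Qed.

Lemma witt_extL (h : int -> V) n : witt_ext h (wittL n) = h n.
Proof.
rewrite /witt_ext /wittL msuppU oner_eq0 big_seq_fset1 mcoeffU eqxx.
by rewrite mulr1n scale1r.
Qed.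

(* The unique bilinear map sending (wittL i, wittL j) to b i j. *)
Definition witt_bil (b : int -> int -> V) (x y : witt K) : V :=
  witt_ext (fun i => witt_ext (b i) y) x.

Lemma witt_bil_bilinear (b : int -> int -> V) :
  bilinear_for *:%R *:%R (witt_bil b).
Proof.
split=> [y|x]; first exact: witt_ext_linear.
move=> c y z; rewrite /= /witt_bil /witt_ext scaler_sumr -big_split /=.
apply: eq_bigr => k _; rewrite -!/(witt_ext _ _) witt_ext_linear.
by rewrite scalerDr !scalerA mulrC.
Qed.

Lemma witt_bilL (b : int -> int -> V) i j :
  witt_bil b (wittL i) (wittL j) = b i j.
Proof. by rewrite /witt_bil !witt_extL. Qed.

End Ext.

Definition witt_lie : witt K -> witt K -> witt K :=
  witt_bil (fun m n => (m - n)%:~R *: wittL (m + n)).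

Let lieDl (c : K) x y z :
  witt_lie (c *: x + y) z = c *: witt_lie x z + witt_lie y z.
Proof. exact: (witt_bil_bilinear _).1. Qed.

Let lieDr (c : K) x y z :
  witt_lie z (c *: x + y) = c *: witt_lie z x + witt_lie z y.
Proof. exact: (witt_bil_bilinear _).2. Qed.

Let lie0l x : witt_lie 0 x = 0.
Proof. by have := lieDl (-1) 0 0 x; rewrite scaler0 addr0 scaleN1r addNr. Qed.

Let lie0r x : witt_lie x 0 = 0.
Proof. by have := lieDr (-1) 0 0 x; rewrite scaler0 addr0 scaleN1r addNr. Qed.

Let lieL m n : witt_lie (wittL m) (wittL n) = (m - n)%:~R *: wittL (m + n).
Proof. exact: witt_bilL. Qed.

Let lieZr (c : K) x y : witt_lie x (c *: y) = c *: witt_lie x y.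
Proof. by rewrite -[c *: y]addr0 lieDr lie0r addr0. Qed.

Let lieC x y : witt_lie x y = - witt_lie y x.
Proof.
elim/witt_ind: x => [c x x' IH IH'||m]; last first.
- elim/witt_ind: y => [c y y' IH IH'||n]; last first.
  + by rewrite !lieL -scaleNr -intrN opprB addrC [m + n]addrC.
  + by rewrite lie0l lie0r oppr0.
  + by rewrite lieDl lieDr IH IH' opprD scalerN.
- by rewrite lie0l lie0r oppr0.
- by rewrite lieDl lieDr IH IH' opprD scalerN.
Qed.

Lemma witt_liexx x : witt_lie x x = 0.
Proof.
have addZ (c : K) (a b d e : witt K) :
    a = 0 -> e = 0 -> b = - d -> c *: (c *: a + b) + (c *: d + e) = 0.
  by move=> -> -> ->; rewrite scaler0 add0r addr0 scalerN addNr.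
elim/witt_ind: x => [c x y xx yy||n].
- by rewrite lieDl !lieDr; apply: addZ.
- exact: lie0l.
- by rewrite lieL subrr scale0r.
Qed.

Lemma witt_lie_jacobi x y z :
  witt_lie x (witt_lie y z) + witt_lie y (witt_lie z x) +
  witt_lie z (witt_lie x y) = 0.
Proof.
have addZ (c : K) (a b d a' b' d' : witt K) :
    a + b + d = 0 -> a' + b' + d' = 0 ->
    c *: a + a' + (c *: b + b') + (c *: d + d') = 0.
  move=> e e'; rewrite (addrACA (c *: a)) (addrACA (c *: a + c *: b)) e'.
  by rewrite -!scalerDr e scaler0 addr0.
elim/witt_ind: x => [c x x' IH IH'||m]; last first.
- elim/witt_ind: y => [c y y' IH IH'||n]; last first.
  + elim/witt_ind: z => [c z z' IH IH'||p]; last first.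
    * rewrite !lieL !lieZr !lieL !scalerA.
      have -> : n + (p + m) = m + (n + p) by ring.
      have -> : p + (m + n) = m + (n + p) by ring.
      rewrite -!scalerDl !(intrD, intrN) [X in X *: _](_ : _ = 0) ?scale0r //.
      by ring.
    * by rewrite !(lie0l, lie0r) !addr0.
    * by rewrite !(lieDl, lieDr); apply: addZ.
  + by rewrite !(lie0l, lie0r) !addr0.
  + by rewrite !(lieDl, lieDr); apply: addZ.
- by rewrite !(lie0l, lie0r) !addr0.
- by rewrite !(lieDl, lieDr); apply: addZ.
Qed.

HB.instance Definition _ :=
  Lmodule_isLieAlgebra.Build K (witt K)
    (witt_bil_bilinear _) witt_liexx witt_lie_jacobi.

Lemma lie_wittL m n :
  lie (wittL m) (wittL n) = (m - n)%:~R *: wittL (m + n).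
Proof. exact: lieL. Qed.

Definition witt_pi : witt K -> witt K -> witt K :=
  witt_bil (fun i j => lie (wittL i) (wittL j)).

Lemma witt_piE : witt_pi = lie.
Proof.
rewrite /witt_pi; have -> : (fun i j => lie (wittL i) (wittL j)) =
    (fun m n : int => (m - n)%:~R *: wittL (m + n)).
  by apply/funext => i; apply/funext => j; exact: lie_wittL.
by [].
Qed.

Definition witt_theta (n : int) : witt K -> witt K -> witt K :=
  witt_bil (fun i j => wittL (n + i + j)).

End Witt.

Arguments witt_pi : clear implicits.
Arguments witt_theta : clear implicits.

(* Main.v *)
(* Both slots of a delta-biderivation are delta-derivations, and the bracket is
   graded, so the coefficient of L_(i + j + q) in f (L_i, L_j) is, for fixed q,
   a scalar function of (i, j) which is a homogeneous delta-derivation of degree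
   j + q in i and of degree i + q in j. A homogeneous delta-derivation
   L_m |-> a m *: L_(m + k) satisfies
     ((1 - delta) m - delta k) a m = delta (m - k) a 0,
   which together with a few small instances of the derivation identity gives
   a = 0 for delta <> 1, 1/2 and a constant for delta = 1/2. In the latter case
   f is determined by f (L_0, L_0), which is finitely supported. For delta = 1
   it reads k * a m = (k - m) * a 0, and comparing the two slots kills every
   q <> 0 and leaves a multiple of i - j for q = 0. *)
Require Import Defs.
From HB Require Import structures.
From mathcomp Require Import all_boot all_order all_algebra.
From mathcomp Require Import boolp classical_sets functions reals.
From mathcomp Require Import finmap complex monalg.
From mathcomp Require Import ring zify.

Set Implicit Arguments.
Unset Strict Implicit.
Unset Printing Implicit Defensive.

Import GRing.Theory Num.Theory.
Local Open Scope ring_scope.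
Local Open Scope classical_set_scope.

(** Acts as a linear combination tactic: the goal is [c] times a known equation, and what remains is
    an identity for [ring]. *)
Lemma eq_lincomb (K : comNzRingType) (c x y l r : K) :
  l = r -> x - y = c * (l - r) -> x = y.
Proof. by move=> -> /eqP; rewrite subrr mulr0 subr_eq0 => /eqP. Qed.
Arguments eq_lincomb {K} c {x y l r}.

Lemma mulintrI (K : numFieldType) (c : int) (x y : K) :
  c != 0 -> c%:~R * x = c%:~R * y -> x = y.
Proof. by move=> c0; apply: mulfI; rewrite intr_eq0. Qed.
Arguments mulintrI {K} c {x y}.

(* [L_m |-> a m *: L_(m + k)] is a delta-derivation of the Witt algebra. *)
Definition graded_derivation (K : comNzRingType) (delta : K) (k : int)
    (a : int -> K) : Prop :=
  forall m n p : int, p = m + n ->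
  delta * ((m - n - k)%:~R * a n + (m + k - n)%:~R * a m) =
  (m - n)%:~R * a p.

(** * Homogeneous delta-derivations *)

Section GradedDerivation.
Variables (K : numFieldType) (delta : K) (k : int) (a : int -> K).
Hypothesis der_a : graded_derivation delta k a.

Lemma graded_derivation0 (m : int) :
  ((1 - delta) * m%:~R - delta * k%:~R) * a m = delta * (m - k)%:~R * a 0.
Proof.
have e : m = m + 0 by lia.
by apply: (eq_lincomb (-1) (der_a e)); ring.
Qed.

(* Combines the relations at (m, n) = (k, -k), (2k, -k), (-k, 0) and (2k, 0);
   for k = 0 those at (m, 0), (2, 1) and (1, -1). *)
Lemma graded_derivation_vanish0 :
  delta != 1 -> delta != 2^-1 -> a 0 = 0.
Proof.
move=> d1 d2.
have d2' : 1 - 2 * delta != 0.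
  apply: contraNneq d2 => e; apply/eqP; apply: (mulintrI 2) => //.
  by rewrite mulfV ?intr_eq0 //; apply: (eq_lincomb (-1) e); ring.
have [k0|k0] := eqVneq k 0.
  have g m : m != 0 -> (1 - delta) * a m = delta * a 0.
    move=> m0; apply: (mulintrI m m0).
    by apply: (eq_lincomb 1 (graded_derivation0 m)); rewrite k0; ring.
  have e3 : delta * (a 1 + a 2) = a 3.
    have e : 3 = 2 + 1 :> int by [].
    by apply: (eq_lincomb 1 (der_a e)); rewrite k0; ring.
  (* Multiplying [e3] by [1 - delta] turns each value into [delta * a 0], so [delta * a 0] equals
     [2 * delta] times itself. *)
  have da : delta * a 0 = 0.
    apply: (mulfI d2'); rewrite mulr0.
    have -> : (1 - 2 * delta) * (delta * a 0) =
      (1 - delta) * a 3 - delta * ((1 - delta) * a 1 + (1 - delta) * a 2).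
      by rewrite !g //; ring.
    by rewrite -e3; ring.
  have e0 : delta * (a (-1) + a 1) = a 0.
    have e : 0 = 1 + -1 :> int by [].
    apply: (mulintrI 2) => //.
    by apply: (eq_lincomb 1 (der_a e)); rewrite k0; ring.
  have -> : a 0 = (1 - delta) * a 0 + delta * a 0 by ring.
  rewrite da addr0 -e0.
  have -> : (1 - delta) * (delta * (a (-1) + a 1)) =
     delta * ((1 - delta) * a (-1) + (1 - delta) * a 1) by ring.
  by rewrite !g // da addr0 mulr0.
(* At [m = k] the right-hand side of [graded_derivation0] vanishes. *)
have ak : a k = 0.
  apply: (mulfI d2'); apply: (mulintrI k k0).
  by apply: (eq_lincomb 1 (graded_derivation0 k)); ring.
have e1 : delta * a (- k) = 2 * a 0.
  apply: (mulintrI k k0); have e : 0 = k - k by lia.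
  by apply: (eq_lincomb 1 (der_a e)); rewrite ak; ring.
have e2 : delta * a (k *+ 2) = - a 0.
  apply: (mulintrI (k *+ 4)); first by lia.
  have e : k = k *+ 2 - k by lia.
  have := der_a e; rewrite ak => e'.
  have e'' := congr1 ( *%R (2 * k%:~R)) e1.
  rewrite -[LHS]addr0 -(subrr ((2 * k%:~R) * (delta * a (- k)))) {2}e''.
  by apply: (eq_lincomb 1 e'); ring.
(* After multiplication by [delta], [e1] and [e2] eliminate [a (- k)] and [a (2k)]; what is left is
   [a 0] times [2 (delta - 1) (delta + 1)] and [(delta - 1) (delta - 2)]. *)
have f1 := congr1 ( *%R delta) (graded_derivation0 (- k)).
have f2 := congr1 ( *%R delta) (graded_derivation0 (k *+ 2)).
have {}f1 : k%:~R * (2 * (delta ^+ 2 - 1) * a 0) = 0.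
  have -> : k%:~R * (2 * (delta ^+ 2 - 1) * a 0) =
    delta * (delta * (- k - k)%:~R * a 0) * -1 + - k%:~R * (2 * a 0) by ring.
  by rewrite -f1 -e1; ring.
have {}f2 : k%:~R * ((delta ^+ 2 - 3 * delta + 2) * a 0) = 0.
  have -> : k%:~R * ((delta ^+ 2 - 3 * delta + 2) * a 0) =
    delta * (delta * (k *+ 2 - k)%:~R * a 0)
    - (2 - 3 * delta) * k%:~R * - a 0 by ring.
  by rewrite -f2 -e2; ring.
have d1' : 1 - delta != 0 by rewrite subr_eq0 eq_sym.
(* Twice [f2] minus [f1] reads [6 k (1 - delta) a 0 = 0]. *)
apply: (mulfI d1'); apply: (mulintrI (k *+ 6)); first by lia.
apply: (eq_lincomb 2 f2).
have -> : 2 * (k%:~R * ((delta ^+ 2 - 3 * delta + 2) * a 0) - 0) =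
   2 * (k%:~R * ((delta ^+ 2 - 3 * delta + 2) * a 0))
   - k%:~R * (2 * (delta ^+ 2 - 1) * a 0) by rewrite f1 !subr0.
by ring.
Qed.

(** Since [a 0 = 0], a nonzero [a m] forces [(1 - delta) m = delta k], so [n] would be the only
    index with a nonzero value. *)
Lemma graded_derivation_vanish (n : int) :
  delta != 1 -> delta != 2^-1 -> a n = 0.
Proof.
move=> d1 d2; apply/eqP/negP => /negP an0.
have a0 := graded_derivation_vanish0 d1 d2.
have rt m : a m != 0 -> (1 - delta) * m%:~R = delta * k%:~R.
  move=> am0; have /eqP := graded_derivation0 m.
  by rewrite a0 mulr0 mulf_eq0 (negPf am0) orbF subr_eq0 => /eqP.
have am0 m : m != n -> a m = 0.
  move=> mn; apply/eqP/negP => /negP /rt; rewrite -(rt n an0).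
  move/mulfI; rewrite subr_eq0 eq_sym => /(_ d1) /intr_inj /eqP.
  by rewrite (negPf mn).
(* This [t] splits [n] into [n + t] and [- t], both different from [n], with nonzero difference
   [n + 2 t]. *)
pose t : int := `|n| + 1.
have e : n = (n + t) + (- t) by lia.
have := der_a e; rewrite (am0 (n + t)) ?(am0 (- t)); try lia.
move/eqP; rewrite !mulr0 addr0 mulr0 eq_sym mulf_eq0 (negPf an0) orbF.
by rewrite intr_eq0; lia.
Qed.

(** The relation at [(n, 0)] cancels to [a n = a 0] unless [n = k]; that index is reached by
    [k = 2k - k]. *)
Lemma graded_derivation_half (m : int) : delta = 2^-1 -> a m = a 0.
Proof.
move=> d2; have dd : 2 * delta = 1.
  by rewrite d2 mulfV // pnatr_eq0.
have der2 m' n p : p = m' + n -> (m' - n - k)%:~R * a n +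
    (m' + k - n)%:~R * a m' = 2 * (m' - n)%:~R * a p.
  by move=> /der_a e; rewrite -mulrA -e mulrA dd mul1r.
have g n : n != k -> a n = a 0.
  move=> nk; apply: (mulintrI (n - k)); first by lia.
  have e : n = n + 0 by lia.
  by apply: (eq_lincomb (-1) (der2 _ _ _ e)); ring.
have [->|/g //] := eqVneq m k.
have [->//|k0] := eqVneq k 0.
have e : k = k *+ 2 - k by lia.
apply: (mulintrI (k *+ 6)); first by lia.
have := der2 _ _ _ e; rewrite (g (k *+ 2)) ?(g (- k)); try lia.
by move=> /(eq_lincomb (-1)); apply; ring.
Qed.

Lemma graded_derivation_one (m : int) : delta = 1 ->
  k%:~R * a m = (k - m)%:~R * a 0.
Proof.
by move=> d1; apply: (eq_lincomb (-1) (graded_derivation0 m)); rewrite d1; ring.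
Qed.

End GradedDerivation.

(** * Scalar biderivations for delta = 1 *)

Lemma graded_biderivation_one (K : numFieldType) (F : int -> int -> K) (q : int) :
  (forall j, graded_derivation 1 (j + q) (F ^~ j)) ->
  (forall i, graded_derivation 1 (i + q) (F i)) ->
  forall i j, F i j = (q == 0)%:R * (i - j)%:~R * F 1 0.
Proof.
move=> Fl Fr.
have gl i j : (j + q)%:~R * F i j = (j + q - i)%:~R * F 0 j.
  exact: graded_derivation_one (Fl j) i erefl.
have gr i j : (i + q)%:~R * F i j = (i + q - j)%:~R * F i 0.
  exact: graded_derivation_one (Fr i) j erefl.
move=> i j; have [q0|q0] := eqVneq q 0; last first.
  rewrite !mul0r.
  (* The row [i = q] vanishes, hence row and column 0, hence every row except [i = - q]. *)
  have Fq j' : F q j' = 0.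
    have Fq0 : F q 0 = 0.
      by apply: (mulintrI q q0); apply: (eq_lincomb 1 (gl q 0)); ring.
    apply: (mulintrI (q *+ 2)); first by lia.
    by apply: (eq_lincomb 1 (gr q j')); rewrite Fq0; ring.
  have F0j j' : j' != 0 -> F 0 j' = 0.
    move=> j0; apply: (mulintrI j' j0).
    by apply: (eq_lincomb (-1) (gl q j')); rewrite Fq; ring.
  have F00 : F 0 0 = 0.
    apply: (mulintrI (q *+ 2)); first by lia.
    by apply: (eq_lincomb (-1) (gr 0 (- q))); rewrite (F0j (- q)) ?oppr_eq0 //; ring.
  have Fi0 i' : F i' 0 = 0.
    apply: (mulintrI q q0).
    by apply: (eq_lincomb 1 (gl i' 0)); rewrite F00; ring.
  have Fij i' j' : i' + q != 0 -> F i' j' = 0.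
    by move=> iq; apply: (mulintrI _ iq); rewrite gr Fi0 !mulr0.
  have [iq|/Fij //] := eqVneq (i + q) 0.
  (* The remaining row follows from the first-slot identity at [- q = - 2q + q]. *)
  have e : i = q *- 2 + q by lia.
  have := Fl j _ _ _ e; rewrite Fq Fij; last by lia.
  rewrite !mulr0 addr0 mulr0 => /esym /eqP.
  by rewrite mulf_eq0 intr_eq0 => /orP[|/eqP//]; lia.
subst q; rewrite mul1r.
have F00 : F 0 0 = 0.
  by have e := gl 1 0; apply: (eq_lincomb 1 e); ring.
(* Computing [i' j' F i' j'] through each slot links the axis values [F i' 0] and [F 0 j']. *)
have uv i' j' : i' != 0 -> j' != 0 -> i' != j' ->
    j'%:~R * F i' 0 = - i'%:~R * F 0 j'.
  move=> i0 j0 ij; apply: (mulintrI (i' - j')); first by lia.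
  have e1 := congr1 ( *%R j'%:~R) (gr i' j').
  have e2 := congr1 ( *%R i'%:~R) (gl i' j').
  have e : i'%:~R * ((j' + 0 - i')%:~R * F 0 j') =
      j'%:~R * ((i' + 0 - j')%:~R * F i' 0).
    by rewrite -e1 -e2; ring.
  by apply: (eq_lincomb (-1) e); ring.
have u i' : i' != 0 -> F i' 0 = i'%:~R * F 1 0.
  (* The auxiliary [j'] is nonzero and differs from both [i'] and 1, so [uv] applies to both
     pairs. *)
  move=> i0; pose j' : int := `|i'| *+ 2 + 2.
  apply: (mulintrI j'); first by lia.
  rewrite uv; try lia.
  have e : j'%:~R * F 1 0 = - 1%:~R * F 0 j' by apply: uv; lia.
  by apply: (eq_lincomb (- i'%:~R) e); ring.
have v j' : F 0 j' = - j'%:~R * F 1 0.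
  have [->|j0] := eqVneq j' 0; first by rewrite F00; ring.
  pose i' : int := `|j'| *+ 2 + 2.
  apply: (mulintrI i'); first by lia.
  have e : j'%:~R * F i' 0 = - i'%:~R * F 0 j' by apply: uv; lia.
  rewrite u in e; last by lia.
  by apply: (eq_lincomb 1 e); ring.
have [->|i0] := eqVneq i 0; first by rewrite v; ring.
apply: (mulintrI i i0).
by have e := gr i j; rewrite u // in e; apply: (eq_lincomb 1 e); ring.
Qed.

(** * Bilinear maps and coefficients of the bracket *)

Section Bilinear.
Variables (K : comNzRingType) (U V : lmodType K) (f : U -> U -> V).
Hypothesis bf : bilinear_for *:%R *:%R f.

Lemma bilinDl c x y z : f (c *: x + y) z = c *: f x z + f y z.
Proof. exact: bf.1. Qed.

Lemma bilinDr c x y z : f z (c *: x + y) = c *: f z x + f z y.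
Proof. exact: bf.2. Qed.

Lemma bilin0l z : f 0 z = 0.
Proof. by have := bilinDl (-1) 0 0 z; rewrite scaler0 addr0 scaleN1r addNr. Qed.

Lemma bilin0r z : f z 0 = 0.
Proof. by have := bilinDr (-1) 0 0 z; rewrite scaler0 addr0 scaleN1r addNr. Qed.

Lemma bilinZl c x z : f (c *: x) z = c *: f x z.
Proof. by rewrite -[c *: x]addr0 bilinDl bilin0l addr0. Qed.

Lemma bilinZr c x z : f z (c *: x) = c *: f z x.
Proof. by rewrite -[c *: x]addr0 bilinDr bilin0r addr0. Qed.

End Bilinear.

Lemma witt_bilinear_ext (K : comNzRingType) (V : lmodType K)
    (f g : witt K -> witt K -> V) :
  bilinear_for *:%R *:%R f -> bilinear_for *:%R *:%R g ->
  (forall i j, f (wittL K i) (wittL K j) = g (wittL K i) (wittL K j)) -> f = g.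
Proof.
move=> bf bg fg; apply/funext => x; apply/funext => y.
elim/witt_ind: x => [c x x' IH IH'||i].
- by rewrite (bilinDl bf) (bilinDl bg) IH IH'.
- by rewrite (bilin0l bf) (bilin0l bg).
elim/witt_ind: y => [c y y' IH IH'||j //].
- by rewrite (bilinDr bf) (bilinDr bg) IH IH'.
- by rewrite (bilin0r bf) (bilin0r bg).
Qed.

Lemma lieC (K : comNzRingType) (L : lieAlgType K) (x y : L) :
  lie x y = - lie y x.
Proof.
have bl := @lie_bilinear K L.
have := liexx (1 *: x + y).
rewrite (bilinDl bl) !(bilinDr bl) !liexx !scale1r addr0 add0r => /eqP.
by rewrite addr_eq0 => /eqP.
Qed.

(** Only the term of [x] in degree [p - m] contributes, with structure constant
    [m - (p - m) = 2m - p]. *)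
Lemma mcoeff_lieL (K : comNzRingType) (m p : int) (x : witt K) :
  mcoeff p (lie (wittL K m) x) = (m *+ 2 - p)%:~R * mcoeff (p - m) x.
Proof.
have bl := @lie_bilinear K (witt K).
elim/witt_ind: x => [c x y IHx IHy||n].
- rewrite (bilinDr bl) !mcoeffD !(mcoeffZ (K := int)) IHx IHy; ring.
- by rewrite (bilin0r bl) !mcoeff0 mulr0.
rewrite lie_wittL (mcoeffZ (K := int)) /wittL !mcoeffU.
have -> : (n == p - m) = (m + n == p) by lia.
case: eqP => [<-|_]; last by rewrite !mulr0.
by congr (_%:~R * _); lia.
Qed.

Lemma mcoeff_witt_lin (K : comNzRingType) (p : int) (a b c : K)
    (x y z : (witt K : lieAlgType K)) :
  a *: x + b *: y = c *: z ->
  a * mcoeff p x + b * mcoeff p y = c * mcoeff p z.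
Proof. by move/(congr1 (mcoeff p)); rewrite mcoeffD !(mcoeffZ (K := int)). Qed.

Lemma mcoeff_lieR (K : comNzRingType) (n p : int) (x : witt K) :
  mcoeff p (lie x (wittL K n)) = (p - n *+ 2)%:~R * mcoeff (p - n) x.
Proof. by rewrite lieC mcoeffN mcoeff_lieL; ring. Qed.

(** Serves for finite combinations of the maps [witt_theta]: their value at [(L_i, L_j)] is the
    value at [(L_0, L_0)] shifted by [i + j]. *)
Lemma mcoeff_witt_ext_shift (K : comNzRingType) (s p : int) (x : witt K) :
  mcoeff p (witt_ext (fun n => wittL K (n + s)) x) = mcoeff (p - s) x.
Proof.
elim/witt_ind: x => [c x y IHx IHy||n].
- by rewrite witt_ext_linear !mcoeffD !(mcoeffZ (K := int)) IHx IHy.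
- by rewrite /witt_ext msupp0 big_nil !mcoeff0.
by rewrite witt_extL /wittL !mcoeffU; congr (_ *+ nat_of_bool _); lia.
Qed.

(** * Biderivations of a general Lie algebra *)

Section Biderivation.
Variables (K : comNzRingType) (L : lieAlgType K) (delta : K).
Implicit Types f g : L -> L -> L.

(** Exchanging the slots exchanges the two axioms, so facts on the first slot carry over to the
    second. *)
Lemma biderivation_swap f :
  biderivation delta f -> biderivation delta (fun x y => f y x).
Proof.
move=> [bf fl fr]; split; first by split=> u; [exact: bf.2|exact: bf.1].
- by move=> x y z; rewrite addrC; exact: fr.
- by move=> x y z; rewrite addrC; exact: fl.
Qed.

Lemma biderivation0 : biderivation delta (0 : L -> L -> L).
Proof.
have bl := @lie_bilinear K L.
split; first by split=> u c x y /=; rewrite scaler0 addr0.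
- by move=> x y z; rewrite (bilin0l bl) (bilin0r bl) scaler0 addr0.
- by move=> x y z; rewrite (bilin0l bl) (bilin0r bl) scaler0 addr0.
Qed.

Lemma biderivationZD (c : K) f g : biderivation delta f ->
  biderivation delta g -> biderivation delta (c *: f + g).
Proof.
have bl := @lie_bilinear K L.
have E x y : (c *: f + g) x y = c *: f x y + g x y by [].
have Z a u v u' v' : a *: (c *: u + v) + a *: (c *: u' + v') =
    c *: (a *: u + a *: u') + (a *: v + a *: v') :> L.
  by rewrite !scalerDr !scalerA (mulrC a c) addrACA.
move=> [bf fl fr] [bg gl gr]; split.
- by split=> u a x y /=;
    rewrite !E ?(bilinDl bf, bilinDl bg) ?(bilinDr bf, bilinDr bg) !scalerDr !scalerA (mulrC c a) addrACA.
- by move=> x y z; rewrite !E (bilinDl bl) (bilinDr bl) Z fl gl.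
- by move=> x y z; rewrite !E (bilinDl bl) (bilinDr bl) Z fr gr.
Qed.

Lemma biderivation_lie : biderivation 1 (lie : L -> L -> L).
Proof.
have bl := @lie_bilinear K L.
have lieN x y : lie x (- y) = - lie x y :> L.
  by rewrite -scaleN1r (bilinZr bl) scaleN1r.
split=> // x y z; rewrite !scale1r; have := lie_jacobi x y z.
  rewrite (lieC (lie x z)) (lieC (lie x y)) (lieC x z) lieN opprK.
  by move/eqP; rewrite addr_eq0 => /eqP.
rewrite (lieC (lie x y)) (lieC x z) lieN -opprD [X in - X]addrC => /eqP.
by rewrite -addrA addr_eq0 => /eqP.
Qed.

Lemma biderivation_span (A : set (L -> L -> L)) :
  A `<=` biderivation delta -> linear_span A `<=` biderivation delta.
Proof.
move=> sA _ [n [c [a [Aa ->]]]].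
elim/big_rec: _ => [|i f _ bf]; first exact: biderivation0.
exact: biderivationZD (sA _ (Aa i)) bf.
Qed.

End Biderivation.

(** Compares coefficients of [L_(m + n + j + q)] in the first axiom at [L_m], [L_n], [L_j]. *)
Lemma biderivation_graded (K : comNzRingType) (delta : K)
    (f : witt K -> witt K -> witt K) (j q : int) :
  biderivation delta f ->
  graded_derivation delta (j + q)
    (fun i => mcoeff (i + j + q) (f (wittL K i) (wittL K j))).
Proof.
move=> [bf fl _] m n _ ->.
have := fl (wittL K m) (wittL K n) (wittL K j).
rewrite (lie_wittL K m n) (bilinZl bf _ (wittL K (m + n))).
move/(mcoeff_witt_lin (m + n + j + q)).
rewrite (mcoeff_lieL m (m + n + j + q) (f (wittL K n) (wittL K j))).
rewrite (mcoeff_lieR n (m + n + j + q) (f (wittL K m) (wittL K j))).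
have -> : m + n + j + q - m = n + j + q by lia.
have -> : m + n + j + q - n = m + j + q by lia.
by move=> <-; ring.
Qed.

(** * The left Leibniz rule and the maps [witt_theta] *)

Section LeftLeibniz.
Variables (K : comNzRingType) (L : lieAlgType K) (delta : K) (f : L -> L -> L).
Hypothesis bf : bilinear_for *:%R *:%R f.

(** Stated for a single triple, so that it extends from basis vectors one argument at a time. *)
Definition left_leibniz x y z : Prop :=
  delta *: lie x (f y z) + delta *: lie (f x z) y = f (lie x y) z.

Let bl := @lie_bilinear K L.

Let scalerZD c (u v u' v' : L) : delta *: (c *: u + v) + delta *: (c *: u' + v') =
  c *: (delta *: u + delta *: u') + (delta *: v + delta *: v').
Proof. by rewrite !scalerDr !scalerA (mulrC delta c) addrACA. Qed.

Lemma left_leibniz0 x y z : x = 0 \/ y = 0 \/ z = 0 -> left_leibniz x y z.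
Proof.
have bil0 := (bilin0l bf, bilin0r bf, bilin0l bl, bilin0r bl, scaler0, addr0).
by move=> [|[|]] ->; rewrite /left_leibniz !bil0.
Qed.

Lemma left_leibnizDl c x x' y z : left_leibniz x y z -> left_leibniz x' y z ->
  left_leibniz (c *: x + x') y z.
Proof.
rewrite /left_leibniz => IH IH'.
by rewrite (bilinDl bf) !(bilinDl bl) (bilinDl bf) scalerZD IH IH'.
Qed.

Lemma left_leibnizDm c x y y' z : left_leibniz x y z -> left_leibniz x y' z ->
  left_leibniz x (c *: y + y') z.
Proof.
rewrite /left_leibniz => IH IH'.
by rewrite (bilinDl bf) !(bilinDr bl) (bilinDl bf) scalerZD IH IH'.
Qed.

Lemma left_leibnizDr c x y z z' : left_leibniz x y z -> left_leibniz x y z' ->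
  left_leibniz x y (c *: z + z').
Proof.
rewrite /left_leibniz => IH IH'.
by rewrite !(bilinDr bf) (bilinDl bl) (bilinDr bl) scalerZD IH IH'.
Qed.

Lemma biderivation_symm : (forall x y, f x y = f y x) ->
  (forall x y z, left_leibniz x y z) -> biderivation delta f.
Proof.
move=> fC fl; split=> // x y z.
by rewrite (fC x y) (fC x z) (fC x (lie y z)) addrC fl.
Qed.

End LeftLeibniz.

Lemma witt_left_leibniz (K : comNzRingType) (delta : K)
    (f : witt K -> witt K -> witt K) (x y z : witt K) :
  bilinear_for *:%R *:%R f ->
  (forall m n p, left_leibniz delta f (wittL K m) (wittL K n) (wittL K p)) ->
  left_leibniz delta f x y z.
Proof.
move=> bf fL.
elim/witt_ind: x => [c x x' IH IH'||m].
- exact: left_leibnizDl.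
- by apply: left_leibniz0 => //; left.
elim/witt_ind: y => [c y y' IH IH'||n].
- exact: left_leibnizDm.
- by apply: left_leibniz0 => //; right; left.
elim/witt_ind: z => [c z z' IH IH'||p //].
- exact: left_leibnizDr.
- by apply: left_leibniz0 => //; right; right.
Qed.

Lemma witt_thetaL (K : comNzRingType) (n i j : int) :
  witt_theta K n (wittL K i) (wittL K j) = wittL K (n + i + j).
Proof. exact: witt_bilL. Qed.

Lemma witt_thetaC (K : comNzRingType) (n : int) (x y : witt K) :
  witt_theta K n x y = witt_theta K n y x.
Proof.
have bt : bilinear_for *:%R *:%R (witt_theta K n) by exact: witt_bil_bilinear.
have bt' : bilinear_for *:%R *:%R (fun x y => witt_theta K n y x).
  by split=> u; [exact: bt.2|exact: bt.1].
have e i j : witt_theta K n (wittL K i) (wittL K j) =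
    witt_theta K n (wittL K j) (wittL K i) by rewrite !witt_thetaL addrAC.
have E : witt_theta K n = (fun x y => witt_theta K n y x).
  exact: witt_bilinear_ext bt bt' e.
by rewrite {1}E.
Qed.

Lemma witt_theta_biderivation (K : numFieldType) (n : int) :
  biderivation 2^-1 (witt_theta K n).
Proof.
have bt : bilinear_for *:%R *:%R (witt_theta K n) by exact: witt_bil_bilinear.
apply: (biderivation_symm bt (@witt_thetaC K n)) => x y z.
apply: witt_left_leibniz => // m p q; rewrite /left_leibniz.
rewrite (lie_wittL K m p) (bilinZl bt _ (wittL K (m + p))) !witt_thetaL.
rewrite (lie_wittL K m (n + p + q)) (lie_wittL K (n + m + q) p) !scalerA.
have -> : m + (n + p + q) = n + (m + p) + q by lia.
have -> : n + m + q + p = n + (m + p) + q by lia.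
(* The structure constants [m - (n + p + q)] and [n + m + q - p] add up to [2 (m - p)]. *)
rewrite -scalerDl -mulrDr; congr (_ *: _).
apply: (mulfI (_ : (2 : K) != 0)); first by rewrite pnatr_eq0.
by rewrite mulrA mulfV ?pnatr_eq0 //; ring.
Qed.

(** * The three cases of the classification *)

Lemma witt_biderivationE (K : numFieldType) (delta : K) :
  biderivation (L := witt K) delta =
    if delta == 1 then [set c *: witt_pi K | c in [set: K]]
    else if delta == 2^-1 then
      linear_span [set witt_theta K n | n in [set: int]]
    else [set 0].
Proof.
(* Every coefficient of [f] at [(L_i, L_j)] is some [F f q i j], so these scalars determine a
   biderivation. *)
pose F (f : witt K -> witt K -> witt K) q i j :=
  mcoeff (i + j + q) (f (wittL K i) (wittL K j)).
have fext f g : biderivation delta f -> biderivation delta g ->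
    (forall q i j, F f q i j = F g q i j) -> f = g.
  move=> [bf _ _] [bg _ _] fg; apply: witt_bilinear_ext => // i j.
  apply/malgP => p; have := fg (p - i - j) i j; rewrite /F.
  by have -> : i + j + (p - i - j) = p by lia.
have Fl f q j : biderivation delta f -> graded_derivation delta (j + q) (F f q ^~ j).
  exact: biderivation_graded.
have Fr f q i : biderivation delta f -> graded_derivation delta (i + q) (F f q i).
  move/biderivation_swap/(biderivation_graded i q).
  by congr graded_derivation; apply/funext => j; rewrite (addrC j).
case: eqVneq => [d1|d1]; [|case: eqVneq => [d2|d2]].
- have bpi c : biderivation delta (c *: witt_pi K).
    rewrite witt_piE -[c *: _]addr0.
    apply: biderivationZD; last exact: biderivation0.
    by rewrite d1; exact: biderivation_lie.
  apply/seteqP; split=> [f bf|_ [c _ <-]] //.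
  (* [witt_pi] sends [(L_1, L_0)] to [L_1], so the scalar must be the coefficient of [L_1] in
     [f (L_1, L_0)]. *)
  exists (F f 0 1 0) => //; apply/esym/fext => // q i j.
  rewrite (graded_biderivation_one (q := q)); last first.
  - by move=> i'; rewrite -d1; exact: Fr.
  - by move=> j'; rewrite -d1; exact: Fl.
  have -> : F (F f 0 1 0 *: witt_pi K) q i j =
      F f 0 1 0 * mcoeff (i + j + q) (witt_pi K (wittL K i) (wittL K j)).
    exact: (mcoeffZ (K := int)).
  rewrite witt_piE lie_wittL (mcoeffZ (K := int)) mcoeffU.
  have [->|q0] := eqVneq q 0.
    by rewrite addr0 eqxx; ring.
  rewrite (_ : (i + j == i + j + q) = false) ?mulr0 ?mul0r //.
  by apply/negbTE; lia.
- apply/seteqP; split=> [f bf|]; last first.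
    by apply: biderivation_span => _ [n _ <-]; rewrite d2; exact: witt_theta_biderivation.
  (* Constancy in both slots makes [f (L_i, L_j)] a shift of [g], so the finite support of [g]
     selects the maps [witt_theta] and its coefficients are their scalars. *)
  pose g := f (wittL K 0) (wittL K 0).
  pose r := enum_fset (msupp g).
  pose c (i : 'I_(size r)) := mcoeff (tnth (in_tuple r) i) g.
  pose t (i : 'I_(size r)) := witt_theta K (tnth (in_tuple r) i).
  have st : linear_span [set witt_theta K n | n in [set: int]] (\sum_i c i *: t i).
    by exists (size r), c, t; split=> // i; exists (tnth (in_tuple r) i).
  suff -> : f = \sum_i c i *: t i by [].
  apply: fext => // [|q i j].
    apply: biderivation_span st => _ [n _ <-]; rewrite d2; exact: witt_theta_biderivation.
  have -> : F f q i j = mcoeff q g.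
    rewrite (graded_derivation_half (Fl f q j bf) i d2).
    by rewrite (graded_derivation_half (Fr f q 0 bf) j d2) /F !add0r.
  rewrite /F.
  have -> : (\sum_i c i *: t i) (wittL K i) (wittL K j) =
      witt_ext (fun n => wittL K (n + (i + j))) g.
    rewrite /witt_ext -/r [RHS]big_tnth !fct_sumE; apply: eq_bigr => k _.
    by rewrite addrA -witt_thetaL.
  by rewrite mcoeff_witt_ext_shift; congr mcoeff; lia.
- apply/seteqP; split=> [f bf|_ ->]; last exact: biderivation0.
  apply: fext => // [|q i j]; first exact: biderivation0.
  by rewrite (graded_derivation_vanish (Fl f q j bf)) // /F mcoeff0.
Qed.

Theorem theorem4p1 (R : realType) (delta : R[i]) :
  biderivation (L := witt R[i]) delta =
    if delta == 1 then [set c *: witt_pi R[i] | c in [set: R[i]]]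
    else if delta == 2^-1 then
      linear_span [set witt_theta R[i] n | n in [set: int]]
    else [set 0].
Proof. exact: witt_biderivationE. Qed.
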